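(* There are exactly $36$ signed graphs with underlying graph the generalized Petersen graph $\mathrm{GP}(7,2)$ up to switching isomorphism.
   Context: All graphs are finite, simple and undirected. The generalized Petersen graph $\mathrm{GP}(n,k)$, for $n\geqslant 3$ and $1\leqslant k\leqslant\lfloor (n-1)/2\rfloor$, has vertex set $\mathbb{Z}_2\times\mathbb{Z}_n$ and edge set $\{(0,j)(0,j+1),\ (0,j)(1,j),\ (1,j)(1,j+k)\mid j=0,1,\ldots,n-1\}$, where sums in the second coordinate are taken modulo $n$. A signed graph is a pair $\Sigma=(\Gamma,\sigma)$ where $\Gamma=(V_\Gamma,E_\Gamma)$ is a graph (the underlying graph) and $\sigma:E_\Gamma\to\{+1,-1\}$ is a sign function. For a switching function $\theta:V_\Gamma\to\{+1,-1\}$, define $\Sigma^\theta=(\Gamma,\sigma^\theta)$ by $\sigma^\theta(uv)=\theta(u)\sigma(uv)\theta(v)$ for every $uv\in E_\Gamma$. Two signed graphs $\Sigma_1,\Sigma_2$ with the same underlying graph $\Gamma$ are switching equivalent if $\Sigma_2=\Sigma_1^\theta$ for some switching function $\theta$. Two signed graphs $(\Gamma_1,\sigma_1)$ and $(\Gamma_2,\sigma_2)$ are isomorphic if there is a graph isomorphism $\Gamma_1\to\Gamma_2$ preserving the signs of edges. Two signed graphs $\Sigma_1,\Sigma_2$ are switching isomorphic if $\Sigma_1$ is isomorphic to a signed graph which is switching equivalent to $\Sigma_2$. *)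

(* Defs.v *)
From HB Require Import structures.
From mathcomp Require Import all_boot all_order all_algebra.

Set Implicit Arguments.
Unset Strict Implicit.
Unset Printing Implicit Defensive.

Import GRing.Theory.

Record sgraph := SGraph {
  vertex :> finType;
  adj : rel vertex;
  adj_sym : symmetric adj;
  adj_irrefl : irreflexive adj }.

Definition edges (G : sgraph) : {set {set G}} :=
  [set [set p.1; p.2] | p : G * G & adj p.1 p.2].

Definition edge (G : sgraph) := {e : {set G} | e \in edges G}.

Lemma edgesP (G : sgraph) (u v : G) : adj u v -> [set u; v] \in edges G.
Proof. by move=> uv; apply/imsetP; exists (u, v) => //; rewrite inE. Qed.

Definition mk_edge (G : sgraph) (u v : G) (uv : adj u v) : edge G :=
  Sub [set u; v] (edgesP uv).

(* The sign group {+1, -1} is encoded as (bool, addb): b stands for (-1)^b,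
   so [true] is the negative sign. *)
Definition signed_graph (G : sgraph) := {ffun edge G -> bool}.

(* Junk value [false] when u and v are not adjacent. *)
Definition sgn (G : sgraph) (S : signed_graph G) (u v : G) : bool :=
  oapp S false (insub [set u; v]).

Lemma sgnE (G : sgraph) (S : signed_graph G) (u v : G) (uv : adj u v) :
  sgn S u v = S (mk_edge uv).
Proof. by rewrite /sgn (insubT (fun e => e \in edges G) (edgesP uv)). Qed.

(* An edge is an unordered pair, hence the product over its two ends; see
   [sgn_switch] for the form theta(u) sigma(uv) theta(v). *)
Definition switch (G : sgraph) (S : signed_graph G) (theta : {ffun G -> bool}) :
    signed_graph G :=
  [ffun e : edge G => S e (+) \big[addb/false]_(x in val e) theta x].

Lemma sgn_switch (G : sgraph) (S : signed_graph G) (theta : {ffun G -> bool})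
    (u v : G) : adj u v ->
  sgn (switch S theta) u v = theta u (+) sgn S u v (+) theta v.
Proof.
move=> uv; have nuv : u != v by apply: contraTneq uv => ->; rewrite adj_irrefl.
rewrite !(sgnE _ uv) ffunE big_setU1 ?inE //= big_set1.
by rewrite addbA [S _ (+) _]addbC.
Qed.

Definition switching_equivalent (G : sgraph) (S1 S2 : signed_graph G) : bool :=
  [exists theta : {ffun G -> bool}, S2 == switch S1 theta].

Definition isomorphic (G1 G2 : sgraph) (S1 : signed_graph G1)
    (S2 : signed_graph G2) : bool :=
  [exists f : {ffun G1 -> G2},
    [&& injectiveb f, #|G1| == #|G2|,
        [forall u, forall v, adj (f u) (f v) == adj u v]
      & [forall u, forall v, adj u v ==> (sgn S2 (f u) (f v) == sgn S1 u v)]]].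

Definition switching_isomorphic (G1 G2 : sgraph) (S1 : signed_graph G1)
    (S2 : signed_graph G2) : bool :=
  [exists S : signed_graph G2, isomorphic S1 S && switching_equivalent S S2].

Lemma sgn_ext (G : sgraph) (S1 S2 : signed_graph G) :
  (forall u v, adj u v -> sgn S1 u v = sgn S2 u v) -> S1 = S2.
Proof.
move=> H; apply/ffunP => -[e he].
have /imsetP[[u v]] := he; rewrite inE /= => uv E.
have -> : exist _ e he = mk_edge uv by apply: val_inj.
by rewrite -!sgnE H.
Qed.

Lemma switching_isomorphicP (G1 G2 : sgraph) (S1 : signed_graph G1)
    (S2 : signed_graph G2) :
  reflect (exists (f : G1 -> G2) (theta : {ffun G2 -> bool}),
    [/\ bijective f, forall u v, adj (f u) (f v) = adj u v
      & forall u v, adj u v -> sgn S2 (f u) (f v)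
                    = theta (f u) (+) sgn S1 u v (+) theta (f v)])
    (switching_isomorphic S1 S2).
Proof.
apply: (iffP existsP) => [[S /andP[/existsP[f /and4P[/injectiveP fi /eqP c
    /'forall_'forall_eqP fa fs]] /existsP[th /eqP ->]]]|[f [th [fb fa fs]]]].
  exists f, th; split=> [|//|u v uv]; first by apply: inj_card_bij => //; rewrite c.
  rewrite sgn_switch ?fa //; move/forallP/(_ u)/forallP/(_ v): fs.
  by rewrite uv => /eqP->.
have K : switch (switch S2 th) th = S2.
  apply: sgn_ext => u v uv; rewrite !sgn_switch //.
  by case: (th u) (th v) (sgn S2 u v) => [] [] [].
exists (switch S2 th); apply/andP; split; last by apply/existsP; exists th; rewrite K.
apply/existsP; exists (finfun f); apply/and4P; split.
- by apply/injectiveP => u v; rewrite !ffunE => /(bij_inj fb).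
- by rewrite (bij_eq_card fb).
- by apply/'forall_'forall_eqP => u v; rewrite !ffunE.
apply/forallP => u; apply/forallP => v; apply/implyP => uv; rewrite !ffunE.
rewrite sgn_switch ?fa // fs //.
by case: (th (f u)) (th (f v)) (sgn S1 u v) => [] [] [].
Qed.

Lemma switching_isomorphic_equiv (G : sgraph) :
  {in [set: signed_graph G] & &, equivalence_rel (@switching_isomorphic G G)}.
Proof.
have R (S : signed_graph G) : switching_isomorphic S S.
  apply/switching_isomorphicP; exists id, [ffun=> false].
  by split=> // [|u v _]; [exists id | rewrite !ffunE addbF].
have Y (S T : signed_graph G) : switching_isomorphic S T -> switching_isomorphic T S.
  move/switching_isomorphicP=> [f [th [[g fK gK] fa fs]]].
  apply/switching_isomorphicP; exists g, [ffun x => th (f x)]; split.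
  - by exists f.
  - by move=> u v; rewrite -fa !gK.
  move=> u v uv; have /fs : adj (g u) (g v) by rewrite -fa !gK.
  rewrite !ffunE !gK => ->.
  by case: (th u) (th v) (sgn S _ _) => [] [] [].
have Z (S T U : signed_graph G) : switching_isomorphic S T ->
    switching_isomorphic T U -> switching_isomorphic S U.
  move/switching_isomorphicP=> [f [th [bf fa fs]]].
  move/switching_isomorphicP=> [g [et [bg ga gs]]].
  have [g' gK g'K] := bg.
  apply/switching_isomorphicP; exists (g \o f), [ffun x => th (g' x) (+) et x].
  split; [exact: bij_comp | by move=> u v /=; rewrite ga fa |].
  move=> u v uv /=; rewrite gs ?fa // fs // !ffunE !gK.
  by case: (th _) (th _) (et _) (et _) (sgn S _ _) => [] [] [] [] [].
move=> S T U _ _ _; split=> [|ST]; first exact: R.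
by apply/idP/idP; apply: Z => //; apply: Y.
Qed.

Definition num_switching_isomorphism_classes (G : sgraph) : nat :=
  #|equivalence_partition (@switching_isomorphic G G) [set: signed_graph G]|.

Section GeneralizedPetersen.

Variables n k : nat.

Local Open Scope ring_scope.

Definition gp_arc (u v : 'Z_2 * 'Z_n) : bool :=
  [|| [&& u.1 == 0, v.1 == 0 & v.2 == u.2 + 1],
      [&& u.1 == 0, v.1 == 1 & v.2 == u.2]
    | [&& u.1 == 1, v.1 == 1 & v.2 == u.2 + k%:R]].

Definition gp_adj (u v : 'Z_2 * 'Z_n) : bool := gp_arc u v || gp_arc v u.

Lemma gp_adj_sym : symmetric gp_adj.
Proof. by move=> u v; rewrite /gp_adj orbC. Qed.

Hypotheses (n_ge3 : (3 <= n)%N) (k_range : (1 <= k <= (n - 1)./2)%N).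

Lemma gp_adj_irrefl : irreflexive gp_adj.
Proof.
move=> [a j]; rewrite /gp_adj orbb /gp_arc /=.
have E (x : 'Z_n) : (j == j + x) = (x == 0).
  by rewrite eq_sym -{2}[j]addr0 (inj_eq (addrI j)).
have k0 : (k%:R == 0 :> 'Z_n) = false.
  have n1 : (1 < n)%N by exact: leq_trans n_ge3.
  apply/negbTE/eqP => /(congr1 val) /=; rewrite val_Zp_nat //.
  case/andP: k_range => k1 k2; rewrite modn_small; first by move: k1; case: (k).
  apply: leq_ltn_trans k2 _; rewrite ltn_half_double -addnn subn1.
  by rewrite prednK ?leq_addr // ltnW.
rewrite !E oner_eq0 k0 !andbF orbF /=.
by case: eqP => // ->.
Qed.

Definition GP : sgraph := SGraph gp_adj_sym gp_adj_irrefl.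

End GeneralizedPetersen.

(* Main.v *)
Require Import Defs.
From mathcomp Require Import all_boot zmodp.

Set Implicit Arguments.
Unset Strict Implicit.
Unset Printing Implicit Defensive.

(** The automorphism group of GP(7,2) is dihedral of order 14, which an
    exhaustive search over partial maps confirms.  With respect to a fixed
    spanning tree, whose cotree has 21 - 13 = 8 edges, a switching class is
    determined by the signs of the 8 fundamental cycles, and all 2^8 sign
    vectors occur.  Switching isomorphism classes are therefore the orbits of
    the dihedral group on 256 sign vectors, and these are counted by
    computation. *)

(** * Counting equivalence classes by representatives *)

Lemma card_equivalence_partition_reps (T : finType) (I : eqType) (R : rel T)
    (l : seq I) (f : I -> T) :
  {in [set: T] & &, equivalence_rel R} -> uniq l ->
  (forall x, exists2 i, i \in l & R x (f i)) ->
  {in l &, forall i j, R (f i) (f j) -> i = j} ->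
  #|equivalence_partition R [set: T]| = size l.
Proof.
move=> eqR ul cov sep.
have Rxx x : R x x by have [] := eqR x x x (in_setT _) (in_setT _) (in_setT _).
have Rxy x y z : R x y -> R x z = R y z.
  by have [] := eqR x y z (in_setT _) (in_setT _) (in_setT _).
have cls x y : R x y ->
    [set z in [set: T] | R x z] = [set z in [set: T] | R y z].
  by move=> xy; apply/setP => z; rewrite !inE; apply: Rxy.
rewrite -(size_map (fun i => [set z in [set: T] | R (f i) z])).
rewrite -(card_uniqP _).
  apply: eq_card => A; apply/imsetP/mapP => [[x _ ->]|[i _ ->]].
    by have [i li xi] := cov x; exists i => //; apply: cls.
  by exists (f i).
rewrite map_inj_in_uniq // => i j li lj /setP/(_ (f j)); rewrite !inE /=.
by rewrite Rxx => /sep; apply.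
Qed.

(** * The graph on the vertices 0, ..., 13 *)

Definition gp72 : sgraph := @GP 7 2 isT isT.

(* The vertex (a, j) is numbered 7 a + j. *)
Definition vtx (i : nat) : gp72 := (inZp (i %/ 7), inZp i).

Definition idx (u : gp72) : nat := 7 * u.1 + u.2.

(* The outer path 0, ..., 6 together with all the spokes. *)
Definition tree : seq (nat * nat) :=
  [seq (i, i.+1) | i <- iota 0 6] ++ [seq (i, i + 7) | i <- iota 0 7].

(** The edge closing the outer 7-cycle, then the inner edges (1,j)(1,j+2). Each edge is listed in
    one orientation only. *)
Definition cotree : seq (nat * nat) :=
  (6, 0) :: [seq (i + 7, (i + 2) %% 7 + 7) | i <- iota 0 7].

Definition arc (i j : nat) : bool := (i, j) \in tree ++ cotree.

Definition adjn (i j : nat) : bool := arc i j || arc j i.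

Lemma adjn_lt i j : adjn i j -> i < 14 /\ j < 14.
Proof.
have H : all (fun p => (p.1 < 14) && (p.2 < 14)) (tree ++ cotree) by [].
by case/orP => /(allP H) /andP[].
Qed.

Lemma vtxK i : i < 14 -> idx (vtx i) = i.
Proof.
have /allP H : all (fun i => idx (vtx i) == i) (iota 0 14) by vm_compute.
by move=> lt; apply/eqP/H; rewrite mem_iota.
Qed.

Lemma idx_lt u : idx u < 14.
Proof.
case: u => [[a lta] [j ltj]]; rewrite /idx /=.
by move: lta ltj; rewrite /Zp_trunc /=; case: a => [|[|]] //;
  case: j => [|[|[|[|[|[|[|]]]]]]].
Qed.

Lemma idxK : cancel idx vtx.
Proof.
case=> [[a lta] [j ltj]]; rewrite /idx /vtx /=; congr (_, _);
  apply: val_inj => /=;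
  by move: lta ltj; rewrite /Zp_trunc /=; case: a => [|[|]] //;
  case: j => [|[|[|[|[|[|[|]]]]]]].
Qed.

Lemma adj_vtx i j : i < 14 -> j < 14 -> adj (vtx i) (vtx j) = adjn i j.
Proof.
have /allP H : all (fun i => all (fun j => adj (vtx i) (vtx j) == adjn i j)
   (iota 0 14)) (iota 0 14) by vm_compute.
by move=> lti ltj; apply/eqP/(allP (H i _)); rewrite mem_iota.
Qed.

Lemma adj_idx u v : adj u v = adjn (idx u) (idx v).
Proof. by rewrite -adj_vtx ?idx_lt // !idxK. Qed.

(** * Switching classes *)

Fixpoint opot (s : rel nat) (i : nat) : bool :=
  if i is j.+1 then opot s j (+) s j i else false.

(* The sign of the tree path from 0 to i. *)
Definition pot (s : rel nat) (i : nat) : bool :=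
  if i < 7 then opot s i else opot s (i - 7) (+) s (i - 7) i.

(* The sign of the closed walk going from 0 to i in the tree, through the
   edge ij, and back to 0 in the tree. *)
Definition dev (s : rel nat) (i j : nat) : bool := pot s i (+) s i j (+) pot s j.

Definition code (s : rel nat) : bitseq := [seq dev s p.1 p.2 | p <- cotree].

(* Only meaningful on edges: all tree edges are positive and the cotree edges
   carry the signs in c. *)
Definition rep (c : bitseq) (i j : nat) : bool :=
  nth false c (index (if (i, j) \in cotree then (i, j) else (j, i)) cotree).

Lemma repC c i j : rep c i j = rep c j i.
Proof.
have /allP H : all (fun p => (p.2, p.1) \notin cotree) cotree by [].
rewrite /rep; case: ifP => [/H /= /negbTE -> // | ij].
(* Neither orientation is listed, so both indices equal [size cotree]. *)
by case: ifP => // ji; rewrite !memNindex ?ij ?ji.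
Qed.

Lemma adjn_path i : i < 6 -> adjn i i.+1.
Proof. by case: i => [|[|[|[|[|[|]]]]]]. Qed.

Lemma adjn_spoke i : i < 7 -> adjn i (i + 7).
Proof. by case: i => [|[|[|[|[|[|[|]]]]]]]. Qed.

Lemma dev_arc s i j : arc i j -> dev s i j = rep (code s) i j.
Proof.
rewrite /arc mem_cat => /orP[]; last first.
  move=> ij; rewrite /rep ij /code (nth_map (0, 0)) ?index_mem //.
  by rewrite nth_index.
rewrite mem_cat => /orP[] /mapP[k]; rewrite mem_iota /= add0n => ltk [-> ->].
  (* A tree edge has index 8, past the end of the code, so [nth] returns its default. *)
  have -> : rep (code s) k k.+1 = false by case: k ltk => [|[|[|[|[|[|]]]]]].
  by rewrite /dev /pot (ltn_trans ltk) // -[k.+1 < 7]/(k < 6) ltk addbb.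
have -> : rep (code s) k (k + 7) = false by case: k ltk => [|[|[|[|[|[|[|]]]]]]].
by rewrite /dev /pot ltk ltnNge leq_addl /= addnK addbb.
Qed.

Lemma dev_adjn s i j : (forall i j, adjn i j -> s i j = s j i) ->
  adjn i j -> dev s i j = rep (code s) i j.
Proof.
move=> sC ij; have [/dev_arc // | /dev_arc ji] := orP ij.
by rewrite repC -ji /dev (sC i j) // addbC addbA addbAC.
Qed.

(** Each inner vertex of the tree path contributes its switching value twice, so only the two ends
    survive. *)
Lemma pot_switch s s' th i :
    (forall i j, adjn i j -> s' i j = th i (+) s i j (+) th j) -> i < 14 ->
  pot s' i = th 0 (+) pot s i (+) th i.
Proof.
move=> ss'; have opot_switch k : k < 7 -> opot s' k = th 0 (+) opot s k (+) th k.
  elim: k => [|k IHk] ltk /=; first by rewrite addbF addbb.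
  rewrite IHk ?(ltnW ltk) // ss' ?adjn_path //.
  by case: (th 0) (th k) (th k.+1) (opot s k) (s k k.+1) => [] [] [] [] [].
rewrite /pot => lti; case: ltnP => [/opot_switch // | le7].
have lti7 : i - 7 < 7 by rewrite ltn_subLR.
have := adjn_spoke lti7; rewrite subnK // => /ss' ->; rewrite opot_switch //.
by case: (th 0) (th (i - 7)) (th i) (opot s _) (s _ _) => [] [] [] [] [].
Qed.

(** The walks measured by [dev] are closed, so the values of [th] cancel. With [th] trivial, this
    says that the code depends only on the signs of edges. *)
Lemma code_switch s s' th :
  (forall i j, adjn i j -> s' i j = th i (+) s i j (+) th j) -> code s' = code s.
Proof.
move=> ss'; apply/eq_in_map => -[i j] ij /=.
have aij : adjn i j by rewrite /adjn /arc mem_cat ij orbT.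
have [lti ltj] := adjn_lt aij.
rewrite /dev !(pot_switch ss') // ss' //.
by case: (th 0) (th i) (th j) (pot s i) (pot s j) (s i j) => [] [] [] [] [] [].
Qed.

(** Switching by the potential makes the whole tree positive. Hence the code is a complete switching
    invariant. *)
Lemma switch_rep s i j : (forall i j, adjn i j -> s i j = s j i) ->
  adjn i j -> s i j = pot s i (+) rep (code s) i j (+) pot s j.
Proof.
move=> sC ij; rewrite -dev_adjn // /dev.
by case: (pot s i) (pot s j) (s i j) => [] [] [].
Qed.

Fixpoint bitseqs n : seq bitseq :=
  if n is m.+1 then map (cons false) (bitseqs m) ++ map (cons true) (bitseqs m)
  else [:: [::]].

Lemma mem_bitseqs c : c \in bitseqs (size c).
Proof.
elim: c => [|b c IHc] //=.
by rewrite mem_cat; apply/orP; case: b; [right|left]; apply: map_f.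
Qed.

Lemma rep_code c : size c = 8 -> code (rep c) = c.
Proof.
have /allP H : all (fun c => code (rep c) == c) (bitseqs 8) by vm_compute.
by move=> sc; apply/eqP/H; rewrite -sc mem_bitseqs.
Qed.

(** * Automorphisms *)

(** Here [g] lists the images of the vertices 0, ..., [size g] - 1, and [x] is a candidate image of
    the next vertex. *)
Definition consistent (g : seq nat) (x : nat) : bool :=
  (x \notin g) &&
  all (fun i => adjn (nth 0 g i) x == adjn i (size g)) (iota 0 (size g)).

Definition extensions (g : seq nat) : seq (seq nat) :=
  [seq rcons g x | x <- iota 0 14 & consistent g x].

Definition partial_auts (k : nat) : seq (seq nat) :=
  iter k (fun l => flatten (map extensions l)) [:: [::]].

(** The maps j -> a + j and j -> a - j, applied to both rims at once; [7 - i %% 7] stands for -j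
    modulo 7. *)
Definition dihedral : seq (seq nat) :=
  [seq [seq 7 * (i %/ 7) + (a + if r then 7 - i %% 7 else i) %% 7
       | i <- iota 0 14] | a <- iota 0 7, r <- [:: false; true]].

(** Completeness of the search: every initial segment of an automorphism passes the test
    [consistent]. *)
Lemma partial_autsP (f : nat -> nat) k : k <= 14 ->
    (forall i, i < 14 -> f i < 14) ->
    {in gtn 14 &, injective f} ->
    {in gtn 14 &, forall i j, adjn (f i) (f j) = adjn i j} ->
  mkseq f k \in partial_auts k.
Proof.
move=> lek f_lt f_inj f_adj; elim: k lek => [|k IHk] ltk //=.
apply/flatten_mapP; exists (mkseq f k); first by apply/IHk/ltnW.
rewrite /mkseq -addn1 iotaD map_cat cats1; apply/mapP; exists (f k) => //.
rewrite mem_filter mem_iota leq0n f_lt // !andbT /consistent size_mkseq.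
apply/andP; split.
  apply/negP => /mapP[i]; rewrite mem_iota add0n => /= lti Ef.
  have Ek : k = i by apply: f_inj; rewrite // inE (ltn_trans lti).
  by rewrite Ek ltnn in lti.
apply/allP => i; rewrite mem_iota add0n => /= lti.
by rewrite nth_mkseq // f_adj // inE (ltn_trans lti).
Qed.

Lemma partial_auts_dihedral : {subset partial_auts 14 <= dihedral}.
Proof. by apply/allP; vm_compute. Qed.

Lemma dihedral_uniq g : g \in dihedral ->
  [/\ size g = 14, uniq g & forall i, i < 14 -> nth 0 g i < 14].
Proof.
have /allP H : all (fun g => [&& size g == 14, uniq g & all (gtn 14) g]) dihedral.
  by vm_compute.
case/H/and3P => /eqP sg ug /allP ltg; split=> // i lti.
by apply/ltg/mem_nth; rewrite sg.
Qed.

Lemma dihedral_adjn g i j : g \in dihedral -> i < 14 -> j < 14 ->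
  adjn (nth 0 g i) (nth 0 g j) = adjn i j.
Proof.
have /allP H : all (fun g => all (fun i => all (fun j =>
  adjn (nth 0 g i) (nth 0 g j) == adjn i j) (iota 0 14)) (iota 0 14)) dihedral.
  by vm_compute.
by move=> gd li lj; apply/eqP/(allP (allP (H g gd) i _)); rewrite mem_iota.
Qed.

Definition act (c : bitseq) (g : seq nat) : bitseq :=
  code (fun i j => rep c (nth 0 g i) (nth 0 g j)).

(** Switching commutes with pulling back along [g]: the potential of [s], pulled back, is the
    switching function required. *)
Lemma act_code s g : (forall i j, adjn i j -> s i j = s j i) -> g \in dihedral ->
  code (fun i j => s (nth 0 g i) (nth 0 g j)) = act (code s) g.
Proof.
move=> sC gd; apply: (@code_switch _ _ (fun i => pot s (nth 0 g i))) => i j ij.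
have [li lj] := adjn_lt ij.
by apply: switch_rep => //; rewrite dihedral_adjn.
Qed.

(** * Switching isomorphism *)

Definition sig (S : signed_graph gp72) (i j : nat) : bool := sgn S (vtx i) (vtx j).

Lemma sigC S i j : sig S i j = sig S j i.
Proof. by rewrite /sig /sgn setUC. Qed.

Lemma switching_isomorphic_code (S T : signed_graph gp72) :
  reflect (exists2 g, g \in dihedral & code (sig S) = act (code (sig T)) g)
          (switching_isomorphic S T).
Proof.
apply: (iffP (switching_isomorphicP S T)) => [[f [th [bf fa fs]]] | [g gd E]].
  pose h i := idx (f (vtx i)).
  have hd : mkseq h 14 \in dihedral.
    apply/partial_auts_dihedral/partial_autsP => // [i _ | i j li lj | i j li lj].
    - exact: idx_lt.
    - move/(can_inj idxK)/(bij_inj bf) => E.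
      by rewrite -(vtxK li) E vtxK.
    - by rewrite -adj_idx fa adj_vtx.
  exists (mkseq h 14) => //; rewrite -act_code; last 2 first.
  - by move=> i j _; apply: sigC.
  - by [].
  symmetry; apply: (@code_switch _ _ (fun i => th (f (vtx i)))) => i j ij.
  have [li lj] := adjn_lt ij.
  by rewrite /sig !nth_mkseq // /h !idxK fs // adj_vtx.
have [sg ug ltg] := dihedral_uniq gd.
pose s i j := sig T (nth 0 g i) (nth 0 g j).
have sC i j : adjn i j -> s i j = s j i by move=> _; apply: sigC.
have tC i j : adjn i j -> sig S i j = sig S j i by move=> _; apply: sigC.
have {}E : code (sig S) = code s.
  by rewrite act_code // => i j _; apply: sigC.
pose f u := vtx (nth 0 g (idx u)).
have f_inj : injective f.
  move=> u v /(congr1 idx); rewrite !vtxK ?ltg ?idx_lt // => /eqP.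
  by rewrite nth_uniq ?sg ?idx_lt // => /eqP/(can_inj idxK).
have f_bij := injF_bij f_inj; have [f' fK f'K] := f_bij.
(* [sig S] and the pullback [s] of [sig T] have the same code, so both switch to the same [rep]. The
   sum of their potentials switches one into the other; [f'] moves it to the target of [f]. *)
exists f, [ffun u => pot s (idx (f' u)) (+) pot (sig S) (idx (f' u))]; split=> //.
  by move=> u v; rewrite /f adj_vtx ?ltg ?idx_lt // dihedral_adjn ?idx_lt // -adj_idx.
move=> u v; rewrite adj_idx => uv; rewrite !ffunE !fK.
have -> : sgn S u v = sig S (idx u) (idx v) by rewrite /sig !idxK.
rewrite -[sgn T _ _]/(s (idx u) (idx v)) (switch_rep tC uv) (switch_rep sC uv) E.
move: (pot s _) (pot s _) (pot (sig S) _) (pot (sig S) _) (rep _ _ _).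
by do 5!case.
Qed.

(** * Realizing codes by signed graphs and counting orbits *)

Definition signing (G : sgraph) (r : rel G) : signed_graph G :=
  [ffun e : edge G =>
    [exists p : G * G, [&& adj p.1 p.2, val e == [set p.1; p.2] & r p.1 p.2]]].

Lemma sgn_signing (G : sgraph) (r : rel G) u v : symmetric r -> adj u v ->
  sgn (signing r) u v = r u v.
Proof.
move=> rC uv; rewrite (sgnE _ uv) ffunE /=.
apply/existsP/idP => [[[x y] /and3P[/= xy /eqP E rxy]] | ruv]; last first.
  by exists (u, v); rewrite /= uv eqxx.
have nuv : u != v by apply: contraTneq uv => ->; rewrite adj_irrefl.
have := set21 u v; have := set22 u v; rewrite E !inE.
case/orP => /eqP Ev; case/orP => /eqP Eu; move: nuv rxy; rewrite Ev Eu ?eqxx //.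
by rewrite rC.
Qed.

Definition sg_of_code (c : bitseq) : signed_graph gp72 :=
  signing (fun u v : gp72 => rep c (idx u) (idx v)).

Lemma sg_of_codeK c : size c = 8 -> code (sig (sg_of_code c)) = c.
Proof.
move=> sc; rewrite -[RHS]rep_code //.
(* Trivial switching: the two signatures agree on edges. *)
apply: (@code_switch _ _ xpred0) => i j ij; have [li lj] := adjn_lt ij.
by rewrite addbF /sig sgn_signing ?adj_vtx // ?vtxK // => u v; apply: repC.
Qed.

(** Greedy choice: a code is skipped when its orbit already meets the list. *)
Definition reps : seq bitseq :=
  foldr (fun c l => if has (fun g => act c g \in l) dihedral then l else c :: l)
    [::] (bitseqs 8).

Definition code_transversal (l : seq bitseq) : bool :=
  [&& uniq l, all (fun c => size c == 8) l,
      all (fun c => has (fun g => act c g \in l) dihedral) (bitseqs 8)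
    & all (fun c => all (fun g => (act c g \in l) ==> (act c g == c)) dihedral) l].

(** A list meeting every orbit exactly once certifies the count, however it was found. *)
Lemma card_classes_transversal l : code_transversal l ->
  num_switching_isomorphism_classes gp72 = size l.
Proof.
case/and4P => ul /allP s8 /allP cov /allP sep.
have {}s8 c : c \in l -> size c = 8 by move/s8/eqP.
have eqv := @switching_isomorphic_equiv gp72.
have siC (S T : signed_graph gp72) :
    switching_isomorphic S T -> switching_isomorphic T S.
  move=> ST; have [SS E] := eqv S T S (in_setT _) (in_setT _) (in_setT _).
  by rewrite -E.
apply: (@card_equivalence_partition_reps _ _ _ _ sg_of_code) => //.
  move=> S; have : code (sig S) \in bitseqs 8.
    by rewrite -[8]/(size (code (sig S))) mem_bitseqs.
  (* The group element found acts on the code of [S], which makes [S] the second argument in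
     [switching_isomorphic_code]; hence the use of symmetry. *)
  case/cov/hasP => g gd lc; exists (act (code (sig S)) g) => //; apply: siC.
  by apply/switching_isomorphic_code; exists g => //; rewrite sg_of_codeK ?s8.
move=> c d lc ld /switching_isomorphic_code[g gd].
rewrite !sg_of_codeK ?s8 // => E.
by have /allP/(_ g gd) := sep d ld; rewrite -E lc => /eqP.
Qed.

Lemma reps_transversal : code_transversal reps.
Proof. by vm_compute. Qed.

Lemma size_reps : size reps = 36.
Proof. by vm_compute. Qed.

Theorem theorem4p2 : num_switching_isomorphism_classes (@GP 7 2 isT isT) = 36.
Proof. by rewrite -size_reps; apply: card_classes_transversal reps_transversal. Qed.
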